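(* Let $\sigma\in\mathbb{C}\setminus\{0,-1\}$, $\zeta=1/(1+\sigma)$, and for $m\ge1$ let $$c_m(\sigma)=\frac{1}{m!}\sum_{p=0}^{m-1}\genfrac{\{}{\}}{0pt}{}{p+m-1}{p}_{\ge 2}(-1)^{p+m-1}\zeta^{p+m}$$ be the coefficient of $\tau^m$ in the series $u=\sum_{m=1}^\infty c_m(\sigma)\tau^m$. Then $$c_1(\sigma)=\frac{1}{1+\sigma},\qquad c_m(\sigma)=\frac{(-1)^m\sigma^{m-1}}{m!\,(1+\sigma)^{2m-1}}\sum_{k=0}^{m-1}\left\langle\!\!\left\langle{m-1\atop k}\right\rangle\!\!\right\rangle\frac{(-1)^k}{\sigma^{k+1}},\quad m\ge2.$$
   Context: $\genfrac{\{}{\}}{0pt}{}{n}{k}_{\ge 2}$ is the 2-associated Stirling subset number (second kind): the number of partitions of an $n$-element set into $k$ blocks each of size at least $2$ (with value $1$ for $n=k=0$). $\left\langle\!\left\langle{n\atop k}\right\rangle\!\right\rangle$ are the second-order Eulerian numbers, defined by $\left\langle\!\left\langle{0\atop 0}\right\rangle\!\right\rangle=1$, $\left\langle\!\left\langle{0\atop k}\right\rangle\!\right\rangle=0$ for $k\ne0$, and $\left\langle\!\left\langle{n\atop k}\right\rangle\!\right\rangle=(k+1)\left\langle\!\left\langle{n-1\atop k}\right\rangle\!\right\rangle+(2n-1-k)\left\langle\!\left\langle{n-1\atop k-1}\right\rangle\!\right\rangle$ for $n\ge1$. *)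

(* Defs.v *)
From HB Require Import structures.
From mathcomp Require Import all_boot all_order all_algebra.
From mathcomp Require Import reals complex.

Set Implicit Arguments.
Unset Strict Implicit.
Unset Printing Implicit Defensive.

Import GRing.Theory Num.Theory.
Local Open Scope ring_scope.
Local Open Scope complex_scope.

Definition assoc_stirling2 (n k : nat) : nat :=
  #|[set P : {set {set 'I_n}} |
      [&& partition P [set: 'I_n], #|P| == k &
          [forall B in P, (2 <= #|B|)%N]]]|.

(* The lower index ranges over all integers, so that the term k - 1 = -1 of
   the recurrence is meaningful and no truncated subtraction occurs. *)
Fixpoint eulerian2 (n : nat) (k : int) : int :=
  match n with
  | 0%N => if k == 0 then 1 else 0
  | n'.+1 => (k + 1) * eulerian2 n' k
             + (2 * n%:Z - 1 - k) * eulerian2 n' (k - 1)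
  end.

(* Only meaningful for m >= 1, where the subtraction p + m - 1 is exact. *)
Definition c_coef (R : realType) (sigma : R[i]) (m : nat) : R[i] :=
  let zeta := 1 / (1 + sigma) in
  1 / (m`!)%:R *
  \sum_(0 <= p < m)
    (assoc_stirling2 (p + m - 1) p)%:R * (-1) ^+ (p + m - 1) * zeta ^+ (p + m).

(* Main.v *)
Require Import Defs.
From HB Require Import structures.
From mathcomp Require Import all_boot all_order all_algebra.
From mathcomp Require Import reals complex ring zify.

Set Implicit Arguments.
Unset Strict Implicit.
Unset Printing Implicit Defensive.

Import Order.TTheory GRing.Theory Num.Theory.
Local Open Scope ring_scope.
Local Open Scope complex_scope.

(** Write m = n + 1, x = 1 + sigma, and W(n, p) for the Ward number
    {n+p, p}_{>=2}.  Multiplying c_m by m! x^(2n+1) turns it, up to the sign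
    (-1)^n, into the polynomial
      P_n(x) = sum_p (-1)^p W(n, p) x^(n-p),
    and the same factor turns the right-hand side, for n >= 1, into
    - (-1)^n Q_(n-1)(x), where
      Q_r(x) = sum_k (-1)^k <<r+1, k>> (x - 1)^(r-k).
    So the theorem is the polynomial identity P_(r+1) = - Q_r
    ([ward_poly_eulerian2]).  It holds because P_1 = - Q_0 = -1 and because
    P_(r+1) and Q_r satisfy the same first-order differential recurrence
      Q_(r+1) = ((r+1) (X - 1) - (r+2)) Q_r + X (1 - X) Q_r'
    ([ward_polyS], [eulerian2_polyS]).  Each differential recurrence only
    translates the triangular recurrence of the coefficients: [alt_sum_rec]
    makes the translation for both families at once, the factors n - k being
    produced by derivation ([mul_deriv_alt_sum]).

    The triangular recurrence of the second-order Eulerian numbers is their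
    definition.  For the Ward numbers it is
      W(n+1, p+1) = (p+1) W(n, p+1) + (n+p+1) W(n, p),
    and has to be extracted from the cardinality that defines the associated
    Stirling numbers ([card_assoc_partitions_rec]): in a partition into blocks
    of size at least 2, delete a fixed point x from its block; either a
    partition with a marked block remains, or x was paired with one point.
    Counting is done through [card_assoc_partitions_block] only: partitions
    containing a given block B correspond to partitions of the complement
    of B. *)

(** * Partitions into blocks of size at least two *)

Definition assoc_partitions (T : finType) (D : {set T}) (k : nat) :
    {set {set {set T}}} :=
  [set P | [&& partition P D, #|P| == k & [forall B in P, (2 <= #|B|)%N]]].

Lemma assoc_partitionsP (T : finType) (D : {set T}) k P :
  reflect [/\ partition P D, #|P| = k & forall B, B \in P -> (2 <= #|B|)%N]
          (P \in assoc_partitions D k).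
Proof.
rewrite inE; apply: (iffP and3P) => [[DP /eqP kP /forall_inP P2] | [DP kP P2]].
  by split.
by split=> //; [apply/eqP | apply/forall_inP].
Qed.

(** Removing the block B is a bijection, with inverse [fun P => B |: P]. *)
Lemma card_assoc_partitions_block (T : finType) (D B : {set T}) k :
  B \subset D -> (2 <= #|B|)%N ->
  #|[set P in assoc_partitions D k.+1 | B \in P]|
    = #|assoc_partitions (D :\: B) k|.
Proof.
move=> sBD B2.
have Bn0 : B != set0 by rewrite -card_gt0; apply: ltn_trans B2.
have notinP P : P \in assoc_partitions (D :\: B) k -> B \notin P.
  case/assoc_partitionsP=> DP _ _; apply: contra Bn0 => BP.
  have := partitionS DP BP; rewrite subsetD => /andP[_].
  by rewrite -setI_eq0 setIid.
rewrite -[RHS](card_in_imset (f := fun P => B |: P)); last first.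
  move=> P Q /notinP PB /notinP QB eqPQ.
  by rewrite -(setU1K PB) eqPQ setU1K.
apply: eq_card => P; rewrite inE; apply/andP/imsetP => [[] | [Q QD ->]].
  case/assoc_partitionsP=> DP kP P2 BP; exists (P :\ B); last by rewrite setD1K.
  apply/assoc_partitionsP; split; first exact: partitionD1.
    by apply/eqP; rewrite -eqSS -kP (cardsD1 B P) BP.
  by move=> C /setD1P[_ /P2].
have QB := notinP _ QD; case/assoc_partitionsP: QD => DQ kQ Q2.
split; last exact: setU11.
apply/assoc_partitionsP; split; last by move=> C /setU1P[-> // | /Q2].
  have -> : D = B :|: D :\: B by rewrite setDE setUIr setUCr setIT (setUidPr sBD).
  apply: partitionU1 => //; rewrite -setI_eq0.
  by apply/eqP/setP=> y; rewrite !inE; case: (y \in B).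
by rewrite cardsU1 QB kQ.
Qed.

(** Classify the partitions by the block that contains x. *)
Lemma card_assoc_partitions_pblock (T : finType) (D : {set T}) x k :
  x \in D ->
  #|assoc_partitions D k.+1|
    = (\sum_(B : {set T} | [&& x \in B, B \subset D & (2 <= #|B|)%N])
         #|assoc_partitions (D :\: B) k|)%N.
Proof.
move=> xD; rewrite -sum1_card.
rewrite (partition_big (fun P => pblock P x)
           (fun B : {set T} => [&& x \in B, B \subset D & (2 <= #|B|)%N])) /=.
  apply: eq_bigr => B /and3P[xB sBD B2].
  rewrite -(card_assoc_partitions_block k sBD B2) -sum1_card.
  apply: eq_bigl => P; rewrite inE; case: assoc_partitionsP => //= -[DP _ _].
  have tP := partition_trivIset DP.
  apply/eqP/idP => [<- | BP]; last exact: def_pblock.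
  by rewrite pblock_mem // (cover_partition DP).
move=> P /assoc_partitionsP[DP _ P2].
have xP : pblock P x \in P by rewrite pblock_mem // (cover_partition DP).
by rewrite mem_pblock (cover_partition DP) xD (partitionS DP xP) P2.
Qed.

(** Both sides count the pairs of a partition and one of its blocks. *)
Lemma card_assoc_partitions_marked (T : finType) (D : {set T}) k :
  (k.+1 * #|assoc_partitions D k.+1|)%N
    = (\sum_(B : {set T} | (B \subset D) && (2 <= #|B|))
         #|assoc_partitions (D :\: B) k|)%N.
Proof.
rewrite mulnC -sum_nat_const.
under eq_bigr => P /assoc_partitionsP[_ <- _] do rewrite -sum1_card.
rewrite (exchange_big_dep
           (fun B : {set T} => (B \subset D) && (2 <= #|B|)%N)) /=.
  apply: eq_bigr => B /andP[sBD B2].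
  rewrite -(card_assoc_partitions_block k sBD B2) -sum1_card.
  by apply: eq_bigl => P; rewrite inE.
by move=> P B /assoc_partitionsP[DP _ P2] BP; rewrite (partitionS DP BP) P2.
Qed.

(** The block of x is [x |: B] with B a nonempty subset of [D :\ x], and what
    remains is a partition of [(D :\ x) :\: B].  The sets B of size at least 2
    are those of [card_assoc_partitions_marked] for [D :\ x]; the others are
    the singletons. *)
Lemma card_assoc_partitions_rec (T : finType) (D : {set T}) x k :
  x \in D ->
  #|assoc_partitions D k.+1|
    = (k.+1 * #|assoc_partitions (D :\ x) k.+1|
       + \sum_(B : {set T} | (B \subset D :\ x) && (#|B| == 1))
           #|assoc_partitions ((D :\ x) :\: B) k|)%N.
Proof.
move=> xD; rewrite (card_assoc_partitions_pblock k xD).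
rewrite card_assoc_partitions_marked.
rewrite (reindex_onto (fun B => x |: B) (fun B => B :\ x)) /=; last first.
  by move=> B /and3P[xB _ _]; rewrite setD1K.
rewrite (bigID (fun B : {set T} => (2 <= #|B|)%N)) /=.
have eqD (B : {set T}) : D :\: (x |: B) = (D :\ x) :\: B by rewrite setDDl.
have notinB (B : {set T}) : ((x |: B) :\ x == B) = (x \notin B).
  by apply/eqP/idP => [<-|/setU1K//]; rewrite !inE eqxx.
congr (_ + _)%N; apply: eq_big => B; rewrite ?eqD // notinB setU11 subUset
  sub1set xD subsetD1 cardsU1; case: (x \in B); rewrite /= ?andbF // ?andbT;
  by case: (B \subset D) => //=; lia.
Qed.

(** The Ward numbers, {n+p, p}_{>=2}.  With the excess n = #|D| - p as first
    index, both terms of [card_assoc_partitions_rec] have excess n - 1, so a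
    plain structural recursion on n suffices. *)
Fixpoint ward (n p : nat) : nat :=
  match n, p with
  | 0%N, 0%N => 1%N
  | n'.+1, p'.+1 => (p * ward n' p + (n + p') * ward n' p')%N
  | _, _ => 0%N
  end.

Lemma card_assoc_partitions_ward (T : finType) (D : {set T}) n p :
  #|D| = (n + p)%N -> #|assoc_partitions D p| = ward n p.
Proof.
elim: n p D => [|n IHn] [|p] D cD /=.
- have D0 : D = set0 by apply/eqP; rewrite -cards_eq0 cD.
  apply/eqP/cards1P; exists set0; apply/setP=> P; rewrite D0 in_set1.
  apply/assoc_partitionsP/eqP => [[_ /eqP] | ->].
    by rewrite cards_eq0 => /eqP.
  by split; rewrite ?partition_set0 ?cards0 // => B; rewrite inE.
(* No excess but p.+1 blocks: their sizes add up to at least twice p.+1. *)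
- apply: eq_card0 => P; apply/negP => /assoc_partitionsP[DP kP P2].
  have : (\sum_(B in P) 2 <= \sum_(B in P) #|B|)%N by apply: leq_sum.
  by rewrite -(card_partition DP) sum_nat_const kP cD; lia.
- apply: eq_card0 => P; apply/negP => /assoc_partitionsP[DP kP _].
  have := card_partition DP; rewrite (cards0_eq kP) big_set0 cD; lia.
have /card_gt0P[x xD] : (0 < #|D|)%N by rewrite cD; lia.
have cDx : #|D :\ x| = (n.+1 + p)%N by move: (cardsD1 x D); rewrite xD cD; lia.
rewrite (card_assoc_partitions_rec p xD) IHn; last by rewrite cDx; lia.
congr (_ + _)%N.
transitivity (\sum_(B in [set B : {set T} | B \subset D :\ x & #|B| == 1%N])
                ward n p)%N.
  apply: eq_big => [B | B /andP[sB /eqP B1]]; first by rewrite inE.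
  by apply: IHn; rewrite cardsD (setIidPr sB) B1 cDx; lia.
by rewrite sum_nat_const cards_draws bin1 cDx.
Qed.

Lemma assoc_stirling2_ward n p : assoc_stirling2 (n + p) p = ward n p.
Proof. by apply: card_assoc_partitions_ward; rewrite cardsT card_ord. Qed.

(** * Alternating sums in decreasing powers *)

Definition alt_sum (A : comNzRingType) (u : A) (n : nat) (a : nat -> A) : A :=
  \sum_(k < n.+1) (-1) ^+ k * a k * u ^+ (n - k).

(** Regroup by the coefficient a_k: it enters b_k with the weight al_k, at the
    power u^(n+1-k), and b_(k+1) with the weight be_k, at the power u^(n-k) and
    the opposite sign. *)
Lemma alt_sum_rec (A : comNzRingType) (u : A) n (a b al be : nat -> A) :
  a n.+1 = 0 -> b 0%N = al 0%N * a 0%N ->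
  (forall k, b k.+1 = al k.+1 * a k.+1 + be k * a k) ->
  alt_sum u n.+1 b
    = \sum_(k < n.+1) (-1) ^+ k * ((al k * u - be k) * a k) * u ^+ (n - k).
Proof.
move=> an b0 bS; rewrite /alt_sum big_ord_recl /= b0.
under eq_bigr => k _ do rewrite /bump add1n subSS bS mulrDr mulrDl.
rewrite big_split /= addrA.
have -> : (-1) ^+ 0 * (al 0%N * a 0%N) * u ^+ (n.+1 - 0)
    + \sum_(k < n.+1) (-1) ^+ k.+1 * (al k.+1 * a k.+1) * u ^+ (n - k)
    = \sum_(k < n.+1) (-1) ^+ k * (al k * a k) * u ^+ (n.+1 - k).
  rewrite -(big_mkord xpredT
    (fun k => (-1) ^+ k.+1 * (al k.+1 * a k.+1) * u ^+ (n - k))) /=.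
  rewrite big_nat_recr //= an !mulr0 mul0r addr0 big_mkord [RHS]big_ord_recl.
  by congr (_ + _); apply: eq_bigr => k _; rewrite /bump add1n subSS.
rewrite -big_split /=; apply: eq_bigr => k _ /=.
by rewrite subSn -1?ltnS // !exprS; ring.
Qed.

(** The Euler operator u d/du multiplies u^(n-k) by n - k; this is how weights
    that are affine in k, as in [alt_sum_rec], become differential operators. *)
Lemma mul_deriv_alt_sum (F : comNzRingType) (u : {poly F}) n (a : nat -> F) :
  u^`() = 1 ->
  u * (alt_sum u n (fun k => (a k)%:P))^`()
    = \sum_(k < n.+1) (-1) ^+ k * ((n - k)%:R * (a k)%:P) * u ^+ (n - k).
Proof.
move=> du; rewrite (raddf_sum (@deriv F)) mulr_sumr; apply: eq_bigr => k _ /=.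
have -> : (-1) ^+ k * (a k)%:P = ((-1) ^+ k * a k)%:P :> {poly F}.
  by rewrite polyCM rmorphXn rmorphN1.
rewrite derivM derivC mul0r add0r deriv_exp du mul1r polyCM rmorphXn rmorphN1.
case: (n - k)%N => [|j] /=; first by rewrite mulr0n; ring.
by rewrite exprS -mulr_natl; ring.
Qed.

(** * The differential recurrence of the Ward polynomials *)

Lemma ward_gt n p : (n < p)%N -> ward n p = 0%N.
Proof.
elim: n p => [|n IHn] [|p] //=; rewrite ltnS => np.
by rewrite !IHn ?muln0 //; exact: ltnW.
Qed.

Definition ward_poly (F : comNzRingType) n : {poly F} :=
  alt_sum 'X n (fun p => (ward n p)%:R%:P).

(** Here al_p = p and be_p = n + p + 1, and
    p X - (n+p+1) = n X - (2n+1) + (n-p) (1 - X). *)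
Lemma ward_polyS (F : comNzRingType) n :
  ward_poly F n.+1
    = (n%:R * 'X - (2 * n + 1)%:R) * ward_poly F n
      + 'X * (1 - 'X) * (ward_poly F n)^`().
Proof.
rewrite /ward_poly (alt_sum_rec 'X (a := fun p => (ward n p)%:R%:P)
  (al := fun p => p%:R) (be := fun p => (n.+1 + p)%:R)); first last.
- by move=> p /=; rewrite !polyC_natr natrD !natrM.
- by case: n => [|n] /=; rewrite mul0r.
- by rewrite ward_gt.
rewrite [_ * (1 - 'X)]mulrC -mulrA mul_deriv_alt_sum ?derivX //.
rewrite /alt_sum !mulr_sumr -big_split /=; apply: eq_bigr => p _.
by rewrite natrB -1?ltnS //; ring.
Qed.

(** * The differential recurrence of the second-order Eulerian polynomials *)

Lemma eulerian2S n k :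
  eulerian2 n.+1 k
    = (k + 1) * eulerian2 n k + (2 * n.+1%:Z - 1 - k) * eulerian2 n (k - 1).
Proof. by []. Qed.

Lemma eulerian2_lt0 n k : k < 0 -> eulerian2 n k = 0.
Proof.
elim: n k => [|n IHn] k k0 /=; first by rewrite lt_eqF.
by rewrite !IHn ?mulr0 //; lia.
Qed.

Lemma eulerian2_ge n k : n.+1%:Z <= k -> eulerian2 n.+1 k = 0.
Proof.
elim: n k => [|n IHn] k nk.
  rewrite /= gt_eqF; last lia.
  by case: eqP => [k1|_]; rewrite !mulr0 ?add0r // mulr1; lia.
by rewrite eulerian2S !IHn ?mulr0 //; lia.
Qed.

(** The powers are those of X - 1, which takes the value sigma at 1 + sigma.
    The index is shifted because row 0 is exceptional: <<0, 0>> is nonzero,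
    whereas <<n, n>> vanishes for n >= 1. *)
Definition eulerian2_poly (F : comNzRingType) n : {poly F} :=
  alt_sum ('X - 1) n (fun k => (eulerian2 n.+1 k%:Z)%:~R%:P).

(** Here al_k = k + 1 and be_k = 2n + 2 - k; with u = X - 1,
    (k+1) u - (2n+2-k) = (n+1) u - (n+2) - (n-k) (1 + u). *)
Lemma eulerian2_polyS (F : comNzRingType) n :
  eulerian2_poly F n.+1
    = (n.+1%:R * ('X - 1) - n.+2%:R) * eulerian2_poly F n
      + 'X * (1 - 'X) * (eulerian2_poly F n)^`().
Proof.
rewrite /eulerian2_poly (alt_sum_rec ('X - 1)
  (a := fun k => (eulerian2 n.+1 k%:Z)%:~R%:P)
  (al := fun k => k.+1%:R) (be := fun k => (2 * n + 2)%:R - k%:R)); first last.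
- move=> k; have -> : eulerian2 n.+2 k.+1%:Z
      = k.+2%:Z * eulerian2 n.+1 k.+1%:Z
        + ((2 * n + 2)%:Z - k%:Z) * eulerian2 n.+1 k%:Z.
    rewrite eulerian2S; congr (_ * _ + _ * eulerian2 n.+1 _); lia.
  rewrite rmorphD !rmorphM rmorphB /= polyCD !polyCM polyCB.
  by rewrite -!pmulrn !polyC_natr.
- by rewrite eulerian2S (@eulerian2_lt0 n.+1 (0 - 1)) // mulr0 addr0 !mul1r.
- by rewrite eulerian2_ge.
have -> : 'X * (1 - 'X) = - ('X * ('X - 1)) :> {poly F} by ring.
rewrite mulNr -mulrA mul_deriv_alt_sum ?derivB ?derivX ?derivC ?subr0 //.
rewrite /alt_sum !mulr_sumr -sumrB /=; apply: eq_bigr => k _ /=.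
by rewrite natrB -1?ltnS // -!natr1; ring.
Qed.

Lemma ward_poly_eulerian2 (F : comNzRingType) n :
  ward_poly F n.+1 = - eulerian2_poly F n.
Proof.
elim: n => [|n IHn].
  rewrite /ward_poly /eulerian2_poly /alt_sum big_ord_recl !big_ord1 /=.
  by rewrite polyC0; ring.
rewrite ward_polyS eulerian2_polyS IHn derivN natrD natrM -[n.+2]addn1 natrD.
by ring.
Qed.

(** * Evaluation at 1 + sigma *)

Lemma horner_alt_sum (F : comNzRingType) (u : {poly F}) n (a : nat -> F) x :
  (alt_sum u n (fun k => (a k)%:P)).[x] = alt_sum u.[x] n a.
Proof.
rewrite /alt_sum horner_sum; apply: eq_bigr => k _.
by rewrite -(rmorph_sign (@polyC F)) !hornerM hornerC horner_exp hornerC.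
Qed.

Lemma c_coefS (R : realType) (sigma : R[i]) n :
  1 + sigma != 0 ->
  c_coef sigma n.+1
    = (-1) ^+ n * (ward_poly _ n).[1 + sigma]
      / ((n.+1)`!%:R * (1 + sigma) ^+ (2 * n + 1)).
Proof.
move=> x0; rewrite /c_coef horner_alt_sum hornerX /alt_sum.
rewrite big_mkord mulr_sumr mulr_sumr mulr_suml; apply: eq_bigr => p _.
have f0 : (n.+1)`!%:R != 0 :> R[i] by rewrite pnatr_eq0 -lt0n fact_gt0.
rewrite addnS subn1 /= addnC assoc_stirling2_ward div1r div1r.
set x := 1 + sigma in x0 *.
have -> : x ^+ (2 * n + 1) = x ^+ (n + p).+1 * x ^+ (n - p).
  by rewrite -exprD; congr (_ ^+ _); have := ltn_ord p; lia.
have xk k : x ^+ k != 0 by rewrite expf_neq0.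
rewrite exprVn exprD.
by field; rewrite !xk f0.
Qed.

Theorem mainTheorem11 (R : realType) (sigma : R[i])
    (sigma_neq0 : sigma <> 0) (sigma_neqN1 : sigma <> -1) :
  c_coef sigma 1 = 1 / (1 + sigma) /\
  forall m : nat, (2 <= m)%N ->
    c_coef sigma m =
      (-1) ^+ m * sigma ^+ (m - 1) / ((m`!)%:R * (1 + sigma) ^+ (2 * m - 1)) *
      \sum_(0 <= k < m)
        (eulerian2 (m - 1) k%:Z)%:~R * ((-1) ^+ k / sigma ^+ (k + 1)).
Proof.
have s0 : sigma != 0 by apply/eqP.
have x0 : 1 + sigma != 0 by rewrite addrC addr_eq0; apply/eqP.
split.
  rewrite c_coefS // horner_alt_sum /alt_sum big_ord1 /=.
  by rewrite !expr0 !mul1r.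
case=> [|[|n]] // _; rewrite c_coefS // ward_poly_eulerian2 hornerN.
have -> : (2 * n.+2 - 1)%N = (2 * n.+1 + 1)%N by lia.
(* The term k = n.+1 of the sum vanishes, which leaves the n.+1 terms of
   eulerian2_poly. *)
have -> : \sum_(0 <= k < n.+2)
      (eulerian2 n.+1 k%:Z)%:~R * ((-1) ^+ k / sigma ^+ (k + 1))
    = (eulerian2_poly _ n).[1 + sigma] / sigma ^+ n.+1.
  rewrite big_nat_recr // eulerian2_ge // mul0r [LHS]addr0 big_mkord.
  rewrite horner_alt_sum !hornerE /alt_sum mulr_suml; apply: eq_bigr => k _.
  have -> : 1 + sigma - 1 = sigma by ring.
  have -> : sigma ^+ n.+1 = sigma ^+ (k + 1) * sigma ^+ (n - k).
    by rewrite -exprD; congr (_ ^+ _); have := ltn_ord k; lia.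
  by field; rewrite !expf_neq0.
rewrite subn1 /= [(-1) ^+ n.+2]exprS; field.
by rewrite !expf_neq0 // pnatr_eq0 -lt0n fact_gt0.
Qed.
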